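(* Let $k\in\{2,3,4\}$ and let $a\in\mathbb{F}_{2^k}\setminus\{0,1\}$. Let $\mathbf{u}$ be the $(a,1)$-Thue-Morse sequence. Then the Stieltjes continued fraction $\mathrm{Stiel}(x;\mathbf{u})\in\mathbb{F}_{2^k}[[x]]$ is algebraic over $\mathbb{F}_{2^k}(x)$, and its minimal polynomial is $$p_0(x)+p_1(x)y+p_2(x)y^2+p_4(x)y^4,$$ where \begin{align*} p_0(x)&=\frac{a^2+1}{a^4}\,x^2+\frac{1}{a^5+a^4},\\ p_1(x)&=\frac{a+1}{a^5}\,x+\frac{1}{a^5},\\ p_2(x)&=\frac{1}{a^5}\,x+\frac{1}{a^6+a^5},\\ p_4(x)&=\frac{1}{a^6+a^5}\,x^2. \end{align*}
   Context: For two distinct elements $a,b$ of an alphabet, the $(a,b)$-Thue-Morse sequence is the fixed point $s^\infty(a)$ (starting with $a$) of the substitution $s: a\mapsto ab,\ b\mapsto ba$. For a field $K$ and a sequence $\mathbf{u}=(u_j)_{j\ge0}$ with values in $K^\times$, the Stieltjes continued fraction $$\mathrm{Stiel}(x;\mathbf{u})=\cfrac{u_0}{1+\cfrac{u_1x}{1+\cfrac{u_2x}{1+\cfrac{u_3x}{\ddots}}}}$$ is the limit in $K[[x]]$ (which exists) of the finite fractions $$\mathrm{Stiel}_n(x;\mathbf{u})=\cfrac{u_0}{1+\cfrac{u_1x}{1+\cfrac{u_2x}{1+\cfrac{\ddots}{1+u_nx}}}}\,.$$ Minimal polynomials are not normalized to be monic: ''the minimal polynomial'' means an irreducible annihilating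 polynomial over $\mathbb{F}_{2^k}(x)$, determined up to a nonzero factor in $\mathbb{F}_{2^k}(x)$. *)

(* Defs.v *)
From HB Require Import structures.
From mathcomp Require Import all_boot all_order all_algebra generic_quotient.
From mathcomp Require Import boolp.

Set Implicit Arguments.
Unset Strict Implicit.
Unset Printing Implicit Defensive.

Import GRing.Theory.
Local Open Scope ring_scope.
Local Open Scope quotient_scope.

(* The ring K[[x]]; the coercion f n is the coefficient of x^n in f. *)
Record fps (K : fieldType) := Fps { coefs :> nat -> K }.

Section PowerSeries.
Variable K : fieldType.
Local Notation fps := (fps K).
Implicit Types f g h : fps.

HB.instance Definition _ := [isNew for @coefs K].
HB.instance Definition _ := [Choice of fps by <:].

Lemma fpsP f g : f =1 g <-> f = g.
Proof. by split=> [fg|->//]; apply/val_inj/funext. Qed.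

Definition fps_of_poly (p : {poly K}) : fps := Fps (fun n => p`_n).

Definition fps_add f g : fps := Fps (fun n => f n + g n).
Definition fps_opp f : fps := Fps (fun n => - f n).
Definition fps_mul f g : fps := Fps (fun n => \sum_(i < n.+1) f i * g (n - i)%N).

Fact fps_addA : associative fps_add.
Proof. by move=> f g h; apply/fpsP => n /=; rewrite addrA. Qed.
Fact fps_addC : commutative fps_add.
Proof. by move=> f g; apply/fpsP => n /=; rewrite addrC. Qed.
Fact fps_add0 : left_id (fps_of_poly 0) fps_add.
Proof. by move=> f; apply/fpsP => n /=; rewrite coef0 add0r. Qed.
Fact fps_addN : left_inverse (fps_of_poly 0) fps_opp fps_add.
Proof. by move=> f; apply/fpsP => n /=; rewrite coef0 addNr. Qed.

HB.instance Definition _ :=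
  GRing.isZmodule.Build fps fps_addA fps_addC fps_add0 fps_addN.

Let trunc m f : {poly K} := \poly_(i < m) f i.

Let fps_mulE m n f g : (n < m)%N -> fps_mul f g n = (trunc m f * trunc m g)`_n.
Proof.
move=> nm; rewrite coefM; apply: eq_bigr => i _.
rewrite !coef_poly (leq_ltn_trans (leq_subr _ _) nm).
by rewrite (leq_ltn_trans _ nm) // -ltnS.
Qed.

Fact fps_mulA : associative fps_mul.
Proof.
move=> f g h; apply/fpsP => n.
transitivity ((trunc n.+1 f * (trunc n.+1 g * trunc n.+1 h))`_n).
  rewrite coefM; apply: eq_bigr => i _.
  by rewrite coef_poly ltn_ord (@fps_mulE n.+1) // ltnS leq_subr.
rewrite mulrA coefM; apply: eq_bigr => i _.
by rewrite coef_poly ltnS leq_subr (@fps_mulE n.+1).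
Qed.
Fact fps_mulC : commutative fps_mul.
Proof. by move=> f g; apply/fpsP => n; rewrite !(@fps_mulE n.+1) // mulrC. Qed.
Fact fps_mul1 : left_id (fps_of_poly 1) fps_mul.
Proof.
move=> f; apply/fpsP => n /=; rewrite big_ord_recl coef1 mul1r subn0 big1 ?addr0 //.
by move=> i _; rewrite coef1 mul0r.
Qed.
Fact fps_mulDl : left_distributive fps_mul fps_add.
Proof.
move=> f g h; apply/fpsP => n /=; rewrite -big_split; apply: eq_bigr => i _.
by rewrite mulrDl.
Qed.
Fact fps_1neq0 : fps_of_poly 1 != fps_of_poly 0.
Proof.
by apply/eqP => /fpsP/(_ 0%N)/eqP; rewrite /= coef1 coef0 oner_eq0.
Qed.

HB.instance Definition _ := GRing.Zmodule_isComNzRing.Build fps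
  fps_mulA fps_mulC fps_mul1 fps_mulDl fps_1neq0.

Lemma coef_fpsD f g n : (f + g) n = f n + g n. Proof. by []. Qed.
Lemma coef_fpsM f g n : (f * g) n = \sum_(i < n.+1) f i * g (n - i)%N.
Proof. by []. Qed.
Lemma coef_fps0 n : (0 : fps) n = 0. Proof. exact: coef0. Qed.
Lemma coef_fps1 n : (1 : fps) n = (n == 0%N)%:R. Proof. exact: coef1. Qed.

Fact fps_of_poly_is_zmod_morphism : zmod_morphism fps_of_poly.
Proof. by move=> p q; apply/fpsP => n; rewrite /= coefB. Qed.
Fact fps_of_poly_is_monoid_morphism : monoid_morphism fps_of_poly.
Proof. by split=> // p q; apply/fpsP => n; rewrite /= coefM. Qed.

HB.instance Definition _ := GRing.isZmodMorphism.Build {poly K} fps fps_of_poly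
  fps_of_poly_is_zmod_morphism.
HB.instance Definition _ := GRing.isMonoidMorphism.Build {poly K} fps fps_of_poly
  fps_of_poly_is_monoid_morphism.

Lemma fps_of_poly_inj : injective fps_of_poly.
Proof. by move=> p q /fpsP pq; apply/polyP. Qed.

Lemma coef_fpsXM f n :
  (fps_of_poly 'X * f) n = if n is m.+1 then f m else 0.
Proof.
rewrite coef_fpsM; case: n => [|n]; first by rewrite big_ord1 /= coefX mul0r.
rewrite 2!big_ord_recl /= !coefX mul0r add0r mul1r subSS subn0 big1 ?addr0 //.
by move=> i _; rewrite coefX mul0r.
Qed.

(* The first n coefficients of the inverse of f, when f 0 != 0. *)
Fixpoint fps_inv_seq f n : seq K :=
  if n is m.+1 then
    let s := fps_inv_seq f m in
    rcons s ((f 0%N)^-1 * ((m == 0%N)%:R - \sum_(i < m) f (m - i)%N * s`_i))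
  else [::].

Definition fps_unit : pred fps := fun f => f 0%N != 0.
Definition fps_inv f : fps :=
  if fps_unit f then Fps (fun n => (fps_inv_seq f n.+1)`_n) else f.

Let size_inv_seq f n : size (fps_inv_seq f n) = n.
Proof. by elim: n => //= n IH; rewrite size_rcons IH. Qed.

Let nth_inv_seq f m n : (n < m)%N ->
  (fps_inv_seq f m)`_n = (fps_inv_seq f n.+1)`_n.
Proof.
elim: m => // m IH; rewrite ltnS leq_eqVlt => /orP[/eqP->//|nm].
by rewrite [LHS]/= nth_rcons size_inv_seq nm IH.
Qed.

Lemma fps_invE f n : f 0%N != 0 -> fps_inv f n =
  (f 0%N)^-1 * ((n == 0%N)%:R - \sum_(i < n) f (n - i)%N * fps_inv f i).
Proof.
move=> f0; rewrite /fps_inv /fps_unit f0 [LHS]/= nth_rcons size_inv_seq ltnn eqxx.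
congr (_ * (_ - _)); apply: eq_bigr => i _; congr (_ * _).
exact: nth_inv_seq.
Qed.

Fact fps_mulVf : {in fps_unit, left_inverse 1 fps_inv *%R}.
Proof.
move=> f f0; apply/fpsP => n; rewrite coef_fpsM coef_fps1.
rewrite big_ord_recr /= subnn (fps_invE n) // mulrAC mulVf // mul1r.
rewrite addrC -[RHS](subrK (\sum_(i < n) f (n - i)%N * fps_inv f i)).
by congr (_ + _); apply: eq_bigr => i _; rewrite mulrC.
Qed.
Fact fps_unitPl f g : g * f = 1 -> fps_unit f.
Proof.
move=> /fpsP/(_ 0%N); rewrite coef_fpsM big_ord1 coef_fps1 /fps_unit => gf.
by apply: contra_eq_neq gf => ->; rewrite mulr0 eq_sym oner_eq0.
Qed.
Fact fps_inv_out : {in [predC fps_unit], fps_inv =1 id}.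
Proof. by move=> f; rewrite !inE unfold_in /fps_inv /fps_unit => /negPf->. Qed.

HB.instance Definition _ := GRing.ComNzRing_hasMulInverse.Build fps
  fps_mulVf fps_unitPl fps_inv_out.

Lemma fps_unitE f : (f \is a GRing.unit) = (f 0%N != 0). Proof. by []. Qed.

Fact fps_idomain : GRing.integral_domain_axiom fps.
Proof.
move=> f g fg; apply/negPn/negP; rewrite negb_or => /andP[f0 g0].
have ex h : h != 0 -> exists n, h n != 0.
  move=> h0; apply: contrapT => hn; move/eqP: h0; apply; apply/fpsP => n.
  by rewrite coef_fps0; apply/eqP/negPn/negP => hn0; apply: hn; exists n.
case: (ex_minnP (ex _ f0)) => m fm mP; case: (ex_minnP (ex _ g0)) => n gn nP.
have /fpsP/(_ (m + n)%N) := fg; rewrite coef_fps0 coef_fpsM.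
have mlt : (m < (m + n).+1)%N by rewrite ltnS leq_addr.
rewrite (bigD1 (Ordinal mlt)) //= addKn big1 ?addr0 => [|i im].
  by move/eqP; rewrite mulf_eq0 (negPf fm) (negPf gn).
have [lt_im|lt_mi|eq_im] := ltngtP i m.
- suff /eqP-> : f i == 0 by rewrite mul0r.
  by apply: contraLR lt_im => /mP; rewrite -leqNgt.
- suff /eqP-> : g (m + n - i)%N == 0 by rewrite mulr0.
  have : (m + n - i < n)%N by rewrite ltn_subLR ?ltn_add2r // -ltnS.
  by apply: contraLR => /nP; rewrite -leqNgt.
- by case/eqP: im; apply/val_inj.
Qed.

HB.instance Definition _ := GRing.ComUnitRing_isIntegral.Build fps fps_idomain.

(* Convergence in K[[x]] for the x-adic topology. *)
Definition fps_cvg (s : nat -> fps) f :=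
  forall n, exists N, forall m, (N <= m)%N -> s m n = f n.

Lemma fps_cvg_unique s f g : fps_cvg s f -> fps_cvg s g -> f = g.
Proof.
move=> sf sg; apply/fpsP => n; have [[M sM] [N sN]] := (sf n, sg n).
by rewrite -(sM (maxn M N)) ?leq_maxl // -(sN (maxn M N)) ?leq_maxr.
Qed.

(* The embedding of K(x) into K((x)) = Frac K[[x]]. *)
Definition laurent_of_ratfun (r : {fraction {poly K}}) : {fraction fps} :=
  let: q := repr r in
  FracField.tofrac (fps_of_poly \n_q) / FracField.tofrac (fps_of_poly \d_q).

Local Notation tofracp := (@FracField.tofrac {poly K}).
Local Notation tofracs := (@FracField.tofrac fps).

Let fps_of_poly_neq0 (p : {poly K}) : p != 0 -> tofracs (fps_of_poly p) != 0.
Proof.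
by rewrite tofrac_eq0; apply: contra_neq => p0; apply/fps_of_poly_inj; rewrite p0 rmorph0.
Qed.

Let reprE (r : {fraction {poly K}}) :
  r = tofracp \n_(repr r) / tofracp \d_(repr r).
Proof.
apply: (canRL (mulfK _)); first by rewrite tofrac_eq0 denom_ratioP.
move: (repr r) (reprK r) => q <-; have d0 := denom_ratioP q.
unlock FracField.tofrac; rewrite !piE /FracField.mulf; apply/eqmodP => /=.
by rewrite FracField.equivfE !numden_Ratio ?mulr1 ?oner_eq0 // mulrC.
Qed.

Let ratfun_numden (r : {fraction {poly K}}) :
  exists p q : {poly K}, q != 0 /\ r = tofracp p / tofracp q.
Proof. by exists (\n_(repr r)), (\d_(repr r)); split; [apply: denom_ratioP|apply: reprE]. Qed.

Lemma laurent_of_ratfunE (p q : {poly K}) : q != 0 ->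
  laurent_of_ratfun (tofracp p / tofracp q) =
  tofracs (fps_of_poly p) / tofracs (fps_of_poly q).
Proof.
move=> q0; rewrite /laurent_of_ratfun.
set r := tofracp p / tofracp q; have d0 := denom_ratioP (repr r).
apply/eqP; rewrite eqr_div ?fps_of_poly_neq0 // -!rmorphM /=.
apply/eqP; congr (tofracs (fps_of_poly _)).
apply/eqP; rewrite -tofrac_eq !rmorphM /= -eqr_div ?tofrac_eq0 //.
by rewrite -reprE.
Qed.

Fact laurent_of_ratfun_is_zmod_morphism : zmod_morphism laurent_of_ratfun.
Proof.
move=> r s; have [p [q [q0 ->]]] := ratfun_numden r.
have [p' [q' [q'0 ->]]] := ratfun_numden s.
rewrite !laurent_of_ratfunE // -!mulNr -!rmorphN !addf_div;
  rewrite ?fps_of_poly_neq0 ?tofrac_eq0 //.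
by rewrite -!(rmorphM, rmorphD) laurent_of_ratfunE ?mulf_neq0 // !(rmorphM, rmorphD).
Qed.
Fact laurent_of_ratfun_is_monoid_morphism : monoid_morphism laurent_of_ratfun.
Proof.
split=> [|r s].
  rewrite -[1]divr1 -(rmorph1 tofracp) laurent_of_ratfunE ?oner_eq0 //.
  by rewrite !rmorph1 divr1.
have [p [q [q0 ->]]] := ratfun_numden r.
have [p' [q' [q'0 ->]]] := ratfun_numden s.
rewrite !laurent_of_ratfunE // !mulf_div -!rmorphM laurent_of_ratfunE ?mulf_neq0 //.
Qed.

HB.instance Definition _ := GRing.isZmodMorphism.Build
  {fraction {poly K}} {fraction fps} laurent_of_ratfun
  laurent_of_ratfun_is_zmod_morphism.
HB.instance Definition _ := GRing.isMonoidMorphism.Build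
  {fraction {poly K}} {fraction fps} laurent_of_ratfun
  laurent_of_ratfun_is_monoid_morphism.

End PowerSeries.

Section Stieltjes.
Variable K : fieldType.
Implicit Types (u : nat -> K) (f g : fps K).

(* Stiel_n(x; u): unfolding one level replaces (u_0, u_1, ...) by (u_1, u_2, ...). *)
Fixpoint stieln n u : fps K :=
  if n is m.+1 then
    fps_of_poly (u 0%N)%:P /
      (1 + fps_of_poly 'X * stieln m (fun j => u j.+1))
  else fps_of_poly (u 0%N)%:P.

(* Stiel(x; u): the coefficient of x^n is constant from Stiel_n(x; u) on, see
   stiel_cvg. *)
Definition stiel u : fps K := Fps (fun n => stieln n u n).

Lemma stielnS n u : stieln n.+1 u = fps_of_poly (u 0%N)%:P /
  (1 + fps_of_poly 'X * stieln n (fun j => u j.+1)).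
Proof. by []. Qed.

Lemma stieln_denom_unit f : 1 + fps_of_poly 'X * f \is a GRing.unit.
Proof. by rewrite fps_unitE coef_fpsD coef_fps1 coef_fpsXM addr0 oner_eq0. Qed.

Let fps_inv_ext f g n : f 0%N != 0 ->
  (forall i, (i <= n)%N -> f i = g i) -> f^-1 n = g^-1 n.
Proof.
move=> f0; elim/ltn_ind: n => n IH fg.
have g0 : g 0%N != 0 by rewrite -fg.
rewrite !fps_invE // -fg //; congr (_ * (_ - _)); apply: eq_bigr => i _.
rewrite fg ?leq_subr // -/(fps_inv f i); congr (_ * _); apply: IH => // j ji.
by apply: fg; apply: leq_trans ji (ltnW _).
Qed.

Lemma stieln_stable u m n i : (i <= m)%N -> (i <= n)%N -> stieln m u i = stieln n u i.
Proof.
have denomC (f : fps K) : (1 + fps_of_poly 'X * f) 0%N = 1.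
  by rewrite coef_fpsD coef_fps1 coef_fpsXM addr0.
have stiel0 k v : stieln k v 0%N = v 0%N.
  case: k => [|k]; first by rewrite /= coefC.
  rewrite stielnS coef_fpsM big_ord1 fps_invE ?denomC ?oner_eq0 //.
  by rewrite invr1 mul1r big_ord0 subr0 mulr1 /= coefC.
elim: m n i u => [|m IH] [|n] i u; rewrite ?leqn0.
- by [].
- by move=> /eqP->; rewrite !stiel0.
- by move=> _ /eqP->; rewrite !stiel0.
move=> im in_; rewrite !stielnS !coef_fpsM; apply: eq_bigr => j _; congr (_ * _).
apply: fps_inv_ext => [|l li]; first by rewrite denomC oner_eq0.
rewrite !coef_fpsD !coef_fpsXM; case: l li => // l li; congr (_ + _).
have le_l k : (i <= k.+1 -> l <= k)%N.
  by move=> ik; rewrite -ltnS (leq_trans li) // (leq_trans (leq_subr _ _)).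
by apply: IH; apply: le_l.
Qed.

Lemma stiel_cvg u : fps_cvg (fun n => stieln n u) (stiel u).
Proof. by move=> n; exists n => m nm; apply: stieln_stable. Qed.

End Stieltjes.

Section ThueMorse.
Variable T : eqType.
Implicit Types a b c : T.

Definition tm_subst a b c : seq T := if c == a then [:: a; b] else [:: b; a].

(* s^n(a), of length 2^n *)
Definition tm_word a b n : seq T :=
  iter n (fun w => flatten (map (tm_subst a b) w)) [:: a].

(* Since the words s^n(a) are prefixes of one another (see tm_wordE), the n-th
   letter of s^oo(a) can be read off s^n(a), whose length exceeds n. *)
Definition thue_morse a b n : T := nth a (tm_word a b n) n.

Let tm_wordS a b n :
  tm_word a b n.+1 = flatten (map (tm_subst a b) (tm_word a b n)).
Proof. by []. Qed.

Lemma size_tm_word a b n : size (tm_word a b n) = (2 ^ n)%N.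
Proof.
elim: n => //= n IH; rewrite size_flatten /shape -map_comp.
rewrite (@eq_map _ _ _ (fun=> 2%N)) => [|c /=]; last by rewrite /tm_subst; case: ifP.
by rewrite expnSr -IH; elim: (tm_word _ _ _) => //= x s ->; rewrite mulSn.
Qed.

Let tm_word_step a b n : prefix (tm_word a b n) (tm_word a b n.+1).
Proof.
elim: n => [|n /prefixP[w Ew]]; first by rewrite /= /tm_subst eqxx /= eqxx.
by rewrite tm_wordS [in X in prefix _ X]tm_wordS Ew map_cat flatten_cat prefix_prefix.
Qed.

Let tm_word_prefix a b m n : (m <= n)%N -> prefix (tm_word a b m) (tm_word a b n).
Proof.
move/subnK <-; elim: (n - m)%N => [|k IH]; first exact: prefix_refl.
exact: prefix_trans IH (tm_word_step _ _ _).
Qed.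

Let nth_tm_word a b n i : (i < 2 ^ n)%N -> nth a (tm_word a b n) i = thue_morse a b i.
Proof.
move=> lt_in; rewrite /thue_morse; have [le_in|/ltnW le_ni] := leqP i n.
  case/prefixP: (tm_word_prefix a b le_in) => w ->.
  by rewrite nth_cat size_tm_word ltn_expl.
case/prefixP: (tm_word_prefix a b le_ni) => w ->.
by rewrite nth_cat size_tm_word lt_in.
Qed.

Lemma tm_wordE a b n : tm_word a b n = mkseq (thue_morse a b) (2 ^ n).
Proof.
apply: (@eq_from_nth _ a) => [|i]; rewrite size_tm_word ?size_mkseq // => lt_i.
by rewrite nth_mkseq // nth_tm_word.
Qed.

Lemma thue_morse0 a b : thue_morse a b 0 = a. Proof. by []. Qed.

(* thue_morse a b is a fixed point of the substitution *)
Lemma thue_morse_fixed a b n :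
  [:: thue_morse a b n.*2; thue_morse a b n.*2.+1] =
  tm_subst a b (thue_morse a b n).
Proof.
have lt_n : (n < 2 ^ n)%N by rewrite ltn_expl.
have ltS i : (i < n.*2.+2)%N -> (i < 2 ^ n.+1)%N.
  by move=> lt_i; rewrite (leq_trans lt_i) // expnS mul2n -doubleS leq_double.
rewrite -(@nth_tm_word a b n.+1 n.*2) ?ltS //.
rewrite -(@nth_tm_word a b n.+1 n.*2.+1) ?ltS // -(nth_tm_word a b lt_n) tm_wordS.
move: lt_n; rewrite -(size_tm_word a b).
move: (tm_word a b n) {ltS} => w; elim: w n => // c w IH [|n] lt_n.
  by rewrite /= /tm_subst; case: ifP.
by rewrite [RHS]/= -IH //= /tm_subst; case: ifP.
Qed.

End ThueMorse.

(* Main.v *)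
Require Import Defs.
From mathcomp Require Import all_boot all_order all_algebra.
From mathcomp Require Import all_field generic_quotient ring zify.
Set Implicit Arguments.
Unset Strict Implicit.
Unset Printing Implicit Defensive.
Import GRing.Theory.
Local Open Scope ring_scope.

(** Write b = a + 1 and t = 1 + b x.  Up to the constant a^5 b, the announced
polynomial is
  Q(y) = x^2 y^4 + t y^2 + b t y + a (1 + b^3 x^2)   ([stieltjes_quartic]).

Annihilation.  A level u / (1 + x y) of the continued fraction is the Moebius
action of the matrix [[0, u], [x, 1]], of trace 1.  Let A and B be the products
of these matrices along s^(2m)(a) and s^(2m)(1), m >= 1; the next pair is ABBA
and BAAB.
In characteristic 2 the Thue-Morse trace map is monomial, and the recursion
solves explicitly: up to a scalar factor,
  A = [[d, p], [x, 1 + d]]   with d = a x + a x^2 + g + g^2, p = a t + b g,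
B has a similar form and the same determinant, and passing to ABBA replaces g by g + e / t, where
  e = g^4 + t g + a^2 x^4 = det A   ([mx_act_ABBA], [mx_act_BAAB]).
Since t^4 e' = e^4 for the new determinant e' ([detAB_next]), e tends to 0
x-adically.  The convergent attached to the word is y = p / (1 + d); as
e = d (1 + d) + x p, the product x y tends to d, and
  x^2 Q(d / x) = e (e + b x)
holds identically ([scaled_quartic_diagA]).  Hence Q vanishes at the limit.

Irreducibility.  Choose e0 in K with e0^4 = a b^3, which is possible because
Frobenius is onto.  Then
  Q(z + e0) = x^2 z^4 + t z^2 + b t z + beta x + gamma,  beta <> 0,
whose Newton polygon at x = oo has the single slope 1/4 (after x = 1/s it is
Eisenstein at s).  So z behaves like x^(-1/4), and the polynomial cannot split.
To see this with degrees only, substitute x = l T^4 and z = 1 / T: for a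
polynomial in z of degree at most 3 the resulting degree in T does not depend
on l <> 0 ([size_newton_poly]), because the degrees of its terms are distinct
modulo 4, whereas for Q(z + e0) it drops exactly when l = - beta
([coef_newton_quartic]). *)

(** * Computing in characteristic 2 *)

Section CharTwo.
Variable R : comNzRingType.
Hypothesis R2 : 2%:R = 0 :> R.

Lemma natr_even n : ~~ odd n -> n%:R = 0 :> R.
Proof. by move=> n2; rewrite -(even_halfK n2) -muln2 natrM R2 mulr0. Qed.

Lemma natr_odd n : odd n -> n%:R = 1 :> R.
Proof. by case: n => // n /= n2; rewrite -natr1 natr_even ?add0r. Qed.

End CharTwo.

(** [ring] modulo 2: the tactic normalizes both sides with natural coefficients,
and each coefficient up to 12 is then rewritten to its parity.  The bound 12
suffices for the identities below. *)
Ltac ring_char2 R2 :=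
  let e n := constr:(natr_even R2 (n:=n) isT) in
  let o n := constr:(natr_odd R2 (n:=n) isT) in
  let h2 := e 2%N in let h3 := o 3%N in let h4 := e 4%N in let h5 := o 5%N in
  let h6 := e 6%N in let h7 := o 7%N in let h8 := e 8%N in let h9 := o 9%N in
  let h10 := e 10%N in let h11 := o 11%N in let h12 := e 12%N in
  ring: h2 h3 h4 h5 h6 h7 h8 h9 h10 h11 h12.

(** * Transfer matrices of the Thue-Morse words *)

Section Transfer.
Variable R : comNzRingType.
Implicit Types (a x g : R) (v : R * R) (w : seq R).

(** Homogeneous coordinates: if y = v.1 / v.2 then [cf_step x c v] represents
c / (1 + x y). *)
Definition cf_step x c v : R * R := (c * v.2, v.2 + x * v.1).
Definition cf_act x w v : R * R := foldr (cf_step x) v w.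

Lemma cf_act_cat x w1 w2 v : cf_act x (w1 ++ w2) v = cf_act x w1 (cf_act x w2 v).
Proof. exact: foldr_cat. Qed.

(** The closed forms of the transfer matrices of s^(2m)(a) and s^(2m)(1), m >= 1,
up to a scalar factor; [diagA], [offA] are the entries d and p of the former,
[diagB], [offB] those of the latter, and [detAB] is the common determinant. *)
Definition tau a x := 1 + (a + 1) * x.
Definition diagA a x g := a * x + a * x ^+ 2 + g + g ^+ 2.
Definition diagB a x g := x + a * x ^+ 2 + g + g ^+ 2.
Definition offA a x g := a * tau a x + (a + 1) * g.
Definition offB a x g := tau a x + (a + 1) * g.
Definition detAB a x g := g ^+ 4 + tau a x * g + a ^+ 2 * x ^+ 4.

(** The action of the matrix [[d, o], [x, 1 + d]], of trace 1 in characteristic 2. *)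
Definition mx_act x d o v : R * R := (d * v.1 + o * v.2, x * v.1 + (1 + d) * v.2).
Definition scale r v : R * R := (r * v.1, r * v.2).

Hypothesis R2 : 2%:R = 0 :> R.

Lemma diagA_detAB a x g :
  diagA a x g * (1 + diagA a x g) + x * offA a x g = detAB a x g.
Proof. rewrite /diagA /offA /detAB /tau; ring_char2 R2. Qed.

(** The determinant is additive in g up to its constant term, so the increment h
with t h = e leaves e + e + h^4. *)
Lemma detAB_next a x g h : tau a x * h = detAB a x g ->
  tau a x ^+ 4 * detAB a x (g + h) = detAB a x g ^+ 4.
Proof.
move=> gh.
have frob (y z : R) : (y + z) ^+ 4 = y ^+ 4 + z ^+ 4 by ring_char2 R2.
have -> : detAB a x (g + h) = h ^+ 4.
  have -> : detAB a x (g + h) = detAB a x g + tau a x * h + h ^+ 4.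
    rewrite /detAB frob; ring.
  rewrite gh; ring_char2 R2.
by rewrite -exprMn gh.
Qed.

Lemma diagB_diagA a x g : diagB a x g = diagA a x g + (a + 1) * x.
Proof. by rewrite /diagB /diagA; ring_char2 R2. Qed.

Lemma offB_offA a x g : offB a x g = offA a x g + (a + 1) * tau a x.
Proof. by rewrite /offB /offA; ring_char2 R2. Qed.

(** Both M and N have trace 1 and determinant e = A (1 + A) + x p, so M^2 = M + e
and N^2 = N + e; moreover tr (M N) = t^2 for t = 1 + b x.  Cayley-Hamilton and its
polarization give M N^2 M = t^2 M + e (M + N) + e + e^2, where
M + N = b [[x, t], [0, x]]; with e = t h this is t^2 times a matrix of the same
shape as M. *)
Lemma mx_act_palindrome x b A p h v :
    (1 + b * x) * h = A * (1 + A) + x * p ->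
  let M := mx_act x A p in
  let N := mx_act x (A + b * x) (p + b * (1 + b * x)) in
  M (N (N (M v))) = scale ((1 + b * x) ^+ 2) (mx_act x (A + h + h ^+ 2) (p + b * h) v).
Proof.
move=> hE /=; set t := 1 + b * x.
have D : t ^+ 2 * (A + h + h ^+ 2) =
    t ^+ 2 * A + t * (A * (1 + A) + x * p) + (A * (1 + A) + x * p) ^+ 2.
  by rewrite -hE -/t; ring.
have O : t ^+ 2 * (p + b * h) = t ^+ 2 * p + b * t * (A * (1 + A) + x * p).
  by rewrite -hE -/t; ring.
case: v => u v; rewrite /mx_act /scale /=; congr pair.
  transitivity (t ^+ 2 * (A + h + h ^+ 2) * u + t ^+ 2 * (p + b * h) * v); last by ring.
  by rewrite D O /t; ring_char2 R2.
transitivity (t ^+ 2 * x * u + (t ^+ 2 + t ^+ 2 * (A + h + h ^+ 2)) * v); last by ring.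
by rewrite D /t; ring_char2 R2.
Qed.

Lemma mx_actZ x A p r v : mx_act x A p (scale r v) = scale r (mx_act x A p v).
Proof. by rewrite /mx_act /scale /=; congr pair; ring. Qed.

Lemma scale_scale r s v : scale r (scale s v) = scale (r * s) v.
Proof. by rewrite /scale /= !mulrA. Qed.

(** [mx_act_palindrome] shifts d by h + h^2 and p by b h, which is the effect of
replacing g by g + h; the same holds with the two matrices exchanged. *)
Lemma mx_act_ABBA a x g h v : tau a x * h = detAB a x g ->
  let A := mx_act x (diagA a x g) (offA a x g) in
  let B := mx_act x (diagB a x g) (offB a x g) in
  A (B (B (A v))) = scale (tau a x ^+ 2)
    (mx_act x (diagA a x (g + h)) (offA a x (g + h)) v).
Proof.
move=> gh /=; rewrite diagB_diagA offB_offA (mx_act_palindrome (h := h)) ?gh ?diagA_detAB //.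
by congr (scale _ (mx_act _ _ _ _)); rewrite /diagA /offA; ring_char2 R2.
Qed.

Lemma mx_act_BAAB a x g h v : tau a x * h = detAB a x g ->
  let A := mx_act x (diagA a x g) (offA a x g) in
  let B := mx_act x (diagB a x g) (offB a x g) in
  B (A (A (B v))) = scale (tau a x ^+ 2)
    (mx_act x (diagB a x (g + h)) (offB a x (g + h)) v).
Proof.
have dA : diagA a x g = diagB a x g + (a + 1) * x.
  by rewrite diagB_diagA; ring_char2 R2.
have oA : offA a x g = offB a x g + (a + 1) * tau a x.
  by rewrite offB_offA; ring_char2 R2.
move=> gh /=; rewrite dA oA (mx_act_palindrome (h := h)).
  by congr (scale _ (mx_act _ _ _ _)); rewrite /diagB /offB; ring_char2 R2.
by rewrite gh /diagB /offB /detAB /tau; ring_char2 R2.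
Qed.

(** As [scaled_quartic a x (x * y)] equals x^2 Q(y), this form avoids division by x. *)
Definition scaled_quartic a x y := y ^+ 4 + tau a x * y ^+ 2 + (a + 1) * x * tau a x * y
  + a * x ^+ 2 * (1 + (a + 1) ^+ 3 * x ^+ 2).

(** The polynomial z^4 + t z^2 + b x t z is additive, and at z = g + g^2 it equals
(g^4 + t g)^2 + b x (g^4 + t g); the terms without g agree as well. *)
Lemma scaled_quartic_diagA a x g :
  scaled_quartic a x (diagA a x g) = detAB a x g * (detAB a x g + (a + 1) * x).
Proof.
have frob (y z : R) : (y + z) ^+ 2 = y ^+ 2 + z ^+ 2 by ring_char2 R2.
have e4 (y : R) : y ^+ 4 = y ^+ 2 ^+ 2 by rewrite -exprM.
by rewrite /scaled_quartic /diagA /detAB e4 !frob /tau; ring_char2 R2.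
Qed.

Lemma scaled_quarticD a x y z : exists c, scaled_quartic a x (y + z) = scaled_quartic a x y + z * c.
Proof.
exists (z ^+ 3 + tau a x * z + (a + 1) * x * tau a x).
by rewrite /scaled_quartic; ring_char2 R2.
Qed.

End Transfer.

(** * Power series and convergents *)

Section PowerSeries.
Variable K : fieldType.
Local Notation X := (fps_of_poly 'X : fps K).
Implicit Types (f g h : fps K) (u : nat -> K).

Definition fpsC (c : K) : fps K := fps_of_poly c%:P.

Lemma coef_fpsXnM m f n :
  (X ^+ m * f) n = if (n < m)%N then 0 else f (n - m)%N.
Proof.
elim: m n => [|m IH] n; first by rewrite expr0 mul1r subn0.
by rewrite exprS -mulrA coef_fpsXM; case: n => // n; rewrite IH.
Qed.

Lemma eq_fps_modXn m f g : (forall i, (i < m)%N -> f i = g i) ->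
  exists h, f = g + X ^+ m * h.
Proof.
move=> fg; exists (Fps (fun i => (f - g) (i + m)%N)); apply/fpsP => n.
rewrite coef_fpsD coef_fpsXnM; case: ltnP => [/fg->|mn]; first by rewrite addr0.
by rewrite /= subnK // addrC subrK.
Qed.

Lemma fps_eq0_modXn f : (forall m, exists h, f = X ^+ m * h) -> f = 0.
Proof.
move=> fX; apply/fpsP => n; have [h ->] := fX n.+1.
by rewrite coef_fpsXnM ltnSn coef_fps0.
Qed.

(** The product of the transfer matrices applied to (0, 1) is the numerator and
denominator of a convergent, because Stiel_0 = u_0 = u_0 / (1 + x 0). *)
Lemma stieln_cf_act n u :
  let v := cf_act X (map fpsC (mkseq u n.+1)) (0, 1) in
  v.2 0%N = 1 /\ stieln n u * v.2 = v.1.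
Proof.
elim: n u => [|n IH] u.
  split; last by rewrite /= mulr0 addr0.
  rewrite -[LHS]/((1 + X * 0) 0%N).
  by rewrite mulr0 addr0 coef_fps1.
have -> : mkseq u n.+2 = u 0%N :: mkseq (fun j => u j.+1) n.+1.
  by rewrite /mkseq -[iota 0 n.+2]/(0%N :: iota (1 + 0) n.+1) iotaDl /= -map_comp.
move: (mkseq _ _) (IH (fun j => u j.+1)) => w /=.
case: (cf_act _ _ _) => p q /= [q1 sq]; rewrite /cf_step /=; split.
  by rewrite -[LHS]/((q + X * p) 0%N) coef_fpsD coef_fpsXM q1 addr0.
have -> : q + X * p = (1 + X * stieln n (fun j => u j.+1)) * q.
  by rewrite -sq; ring.
by rewrite mulrA divrK ?stieln_denom_unit.
Qed.

End PowerSeries.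

(** * Palindromic recursion of the Thue-Morse words *)

Section Words.
Variables (T : eqType) (a b : T).

Definition tm_iter n (w : seq T) := iter n (fun w => flatten (map (tm_subst a b) w)) w.

Lemma tm_iter_cat n w1 w2 : tm_iter n (w1 ++ w2) = tm_iter n w1 ++ tm_iter n w2.
Proof. by elim: n => //= n ->; rewrite map_cat flatten_cat. Qed.

Lemma tm_iter_doubleS m c :
  tm_iter m.+1.*2 [:: c] = tm_iter m.*2 (tm_iter 2 [:: c]).
Proof. by rewrite /tm_iter -iterD addn2. Qed.

Hypothesis ab : a != b.

Lemma tm_iter_doubleSa m : tm_iter m.+1.*2 [:: a] =
  tm_iter m.*2 [:: a] ++ tm_iter m.*2 [:: b] ++ tm_iter m.*2 [:: b] ++ tm_iter m.*2 [:: a].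
Proof.
by rewrite tm_iter_doubleS /= /tm_subst eqxx /= eqxx eq_sym (negPf ab) -!tm_iter_cat.
Qed.

Lemma tm_iter_doubleSb m : tm_iter m.+1.*2 [:: b] =
  tm_iter m.*2 [:: b] ++ tm_iter m.*2 [:: a] ++ tm_iter m.*2 [:: a] ++ tm_iter m.*2 [:: b].
Proof.
by rewrite tm_iter_doubleS /= /tm_subst eq_sym (negPf ab) /= eqxx eq_sym (negPf ab) -!tm_iter_cat.
Qed.

End Words.

(** * The continued fraction annihilates the quartic *)

Section Algebraic.
Variables (K : fieldType) (k : K).
Hypotheses (K2 : 2%:R = 0 :> K) (k1 : k != 1).
Local Notation X := (fps_of_poly 'X : fps K).
Let a := fpsC k.
Local Notation t := (tau a X).

Lemma fps_char2 : 2%:R = 0 :> fps K.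
Proof.
by rewrite -(rmorph_nat (@fps_of_poly K)) -(rmorph_nat (@polyC K)) K2 !rmorph0.
Qed.
Let R2 := fps_char2.

Lemma tau_unit : t \is a GRing.unit.
Proof. by rewrite /tau mulrC stieln_denom_unit. Qed.

Let act (c : K) m := cf_act X (map (@fpsC K) (tm_iter k 1 m.*2 [:: c])).

(** The closed form starts at the words a11a and 1aa1, with g = 0: the letters
themselves are not of this shape.  The determinant is divisible by x^(m+1), its
order being in fact multiplied by 4 at each step. *)
Lemma cf_act_tm_iter m : exists r g : fps K,
  [/\ exists h, detAB a X g = X ^+ m.+1 * h,
      forall v, act k m.+1 v = scale r (mx_act X (diagA a X g) (offA a X g) v)
    & forall v, act 1 m.+1 v = scale r (mx_act X (diagB a X g) (offB a X g) v)].
Proof.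
elim: m => [|m [r [g [[h gh] IHk IH1]]]].
  exists 1, 0; split.
  - exists (a ^+ 2 * X ^+ 3); rewrite /detAB; ring.
  - move=> [u v]; rewrite /act /= /tm_subst eqxx /= eqxx eq_sym (negPf k1) /=.
    rewrite /cf_act /= /cf_step /scale /mx_act /diagA /offA /tau /=.
    have -> : fpsC 1 = 1 :> fps K by [].
    rewrite -/a; congr pair; ring_char2 R2.
  - move=> [u v]; rewrite /act /= /tm_subst eq_sym (negPf k1) /= eqxx eq_sym (negPf k1) /=.
    rewrite /cf_act /= /cf_step /scale /mx_act /diagB /offB /tau /=.
    have -> : fpsC 1 = 1 :> fps K by [].
    rewrite -/a; congr pair; ring_char2 R2.
rewrite /act in IHk IH1 *.
pose d := t^-1 * detAB a X g.
have td : t * d = detAB a X g by rewrite mulVKr ?tau_unit.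
exists (r ^+ 4 * t ^+ 2), (g + d); split.
- exists (t^-1 ^+ 4 * X ^+ m ^+ 3 * X ^+ 2 * h ^+ 4).
  have /(canRL (mulKr (unitrX 4 tau_unit))) -> := detAB_next R2 td.
  rewrite gh -exprVn !exprS; ring.
- move=> v; rewrite tm_iter_doubleSa // !map_cat !cf_act_cat.
  by rewrite !(IHk, IH1, mx_actZ, scale_scale) (mx_act_ABBA R2 _ td) scale_scale !exprS expr0 !mulr1 !mulrA.
- move=> v; rewrite tm_iter_doubleSb // !map_cat !cf_act_cat.
  by rewrite !(IHk, IH1, mx_actZ, scale_scale) (mx_act_BAAB R2 _ td) scale_scale !exprS expr0 !mulr1 !mulrA.
Qed.

(** The convergent s of index n satisfies x s = d + e / (1 + d), where x^(m+1)
divides e, and agrees with the limit modulo x^m; both corrections change the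
value of the scaled quartic by a multiple of x^m. *)
Lemma scaled_quartic_stiel : scaled_quartic a X (X * stiel (thue_morse k 1)) = 0.
Proof.
apply: fps_eq0_modXn => m.
have [r [g [[h gh] act_k _]]] := cf_act_tm_iter m.
pose n := (2 ^ m.+1.*2).-1.
have nE : n.+1 = (2 ^ m.+1.*2)%N by rewrite prednK ?expn_gt0.
have [] := stieln_cf_act n (thue_morse k 1).
have -> : cf_act X (map (@fpsC K) (mkseq (thue_morse k 1) n.+1)) (0, 1) = act k m.+1 (0, 1).
  by rewrite nE -tm_wordE.
set s := stieln n _; set A := diagA a X g; set p := offA a X g.
have -> : act k m.+1 (0, 1) = (r * p, r * (1 + A)).
  by rewrite act_k /scale /mx_act /= !(mulr0, mulr1, add0r).
move=> q1; rewrite [fst _]/= [snd _]/= => sq.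
have : r * (1 + A) \is a GRing.unit by rewrite fps_unitE [X in X != 0]q1 oner_eq0.
rewrite unitrM => /andP[ru qu].
have {}sq : s * (1 + A) = p.
  by apply: (mulrI ru); rewrite -sq; ring.
have Xs : X * s = A + (1 + A)^-1 * detAB a X g.
  apply: (mulIr qu); rewrite -mulrA sq mulrDl mulrAC mulVr // mul1r.
  by rewrite -diagA_detAB // -/A -/p; ring_char2 R2.
have mn : (m <= n)%N.
  by rewrite -ltnS nE; apply: leq_trans (ltn_expl m (isT : 1 < 2)%N) _; rewrite leq_exp2l //; lia.
have [f ->] : exists f, stiel (thue_morse k 1) = s + X ^+ m * f.
  by apply: eq_fps_modXn => i im; apply: stieln_stable => //; apply: leq_trans mn; apply: ltnW.
rewrite mulrDr Xs.
have [c ->] := scaled_quarticD R2 a X (A + (1 + A)^-1 * detAB a X g) (X * (X ^+ m * f)).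
have [c' ->] := scaled_quarticD R2 a X A ((1 + A)^-1 * detAB a X g).
rewrite scaled_quartic_diagA // gh.
exists (X * h * (X ^+ m.+1 * h + (a + 1) * X) + (1 + A)^-1 * X * h * c' + X * f * c).
by rewrite exprS; ring.
Qed.

End Algebraic.

(** * Newton polygon at infinity *)

Section Newton.
Variable K : fieldType.
Local Notation tofrac := (@FracField.tofrac {poly K}).
Implicit Types (l : K) (g h : {poly {poly K}}).

Lemma coef_comp_polyZXn (p : {poly K}) l m n : (0 < m)%N ->
  (p \Po (l *: 'X^m))`_n = if (m %| n)%N then l ^+ (n %/ m) * p`_(n %/ m) else 0.
Proof.
move=> m0; have -> : l *: 'X^m = (l *: 'X) \Po 'X^m :> {poly K}.
  by rewrite comp_polyZ comp_polyX.
rewrite comp_polyA coef_comp_poly_Xn //; case: ifP => // _.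
move: (n %/ m)%N => {}n; rewrite coef_comp_poly.
under eq_bigr do rewrite exprZn coefZ coefXn.
have [np|pn] := ltnP n (size p).
  rewrite (bigD1 (Ordinal np)) //= eqxx mulr1 mulrC big1 ?addr0 // => i /eqP ni.
  by case: eqP => [E|]; rewrite ?mulr0 //; case: ni; apply: val_inj.
rewrite nth_default // mulr0 big1 // => i _.
by case: eqP => [E|]; rewrite ?mulr0 //; move: (ltn_ord i); rewrite -E ltnNge pn.
Qed.

(** Evaluation at x = l T^4, z = 1 / T, where T is the variable of the target. *)
Definition newton_ev l g : {fraction {poly K}} :=
  (map_poly (tofrac \o comp_poly (l *: 'X^4)) g).[(tofrac 'X)^-1].

Lemma newton_evM l g h : newton_ev l (g * h) = newton_ev l g * newton_ev l h.
Proof. by rewrite /newton_ev rmorphM hornerM. Qed.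

(** [newton_ev] cleared of denominators, for a polynomial of degree at most n in z. *)
Definition newton_poly l n g : {poly K} :=
  \sum_(j < n.+1) (g`_j \Po (l *: 'X^4)) * 'X^(n - j).

Lemma newton_polyE l n g : (size g <= n.+1)%N ->
  tofrac (newton_poly l n g) = tofrac 'X ^+ n * newton_ev l g.
Proof.
move=> gn; have X0 : tofrac 'X != 0 by rewrite tofrac_eq0 polyX_eq0.
rewrite /newton_ev (horner_coef_wide _ (leq_trans (size_poly _ _) gn)).
rewrite mulr_sumr rmorph_sum; apply: eq_bigr => j _.
rewrite coef_map rmorphM rmorphXn /= mulrCA; congr (_ * _).
by rewrite exprVn expfB_cond // (negPf X0) add0n -ltnS.
Qed.

(** The monomial x^i z^j goes to l^i T^(4 i + 3 - j); since j <= 3, the exponent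
determines i and j, and no cancellation occurs. *)
Lemma coef_newton_poly l g k :
  (newton_poly l 3 g)`_k = l ^+ (k %/ 4) * (newton_poly 1 3 g)`_k.
Proof.
rewrite !coef_sum mulr_sumr; apply: eq_bigr => j _; rewrite !coefMXn.
case: ltnP => jk; first by rewrite mulr0.
rewrite !coef_comp_polyZXn //; case: ifP => d4; last by rewrite mulr0.
by rewrite expr1n mul1r; congr (_ ^+ _ * _); have := ltn_ord j; lia.
Qed.

Lemma size_newton_poly l g : l != 0 ->
  size (newton_poly l 3 g) = size (newton_poly 1 3 g).
Proof.
move=> l0; apply/eqP; rewrite eqn_leq; apply/andP; split; apply/leq_sizeP => k kn.
  by rewrite coef_newton_poly [X in _ * X]nth_default ?mulr0.
apply/eqP; have /eqP := nth_default 0 kn.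
by rewrite coef_newton_poly mulf_eq0 expf_eq0 (negPf l0) andbF.
Qed.

Variables (u v : {poly K}) (beta gamma : K).
Hypotheses (u2 : (size u <= 2)%N) (v2 : (size v <= 2)%N).

Definition newton_quartic : {poly {poly K}} :=
  'X^2 *: 'X^4 + u *: 'X^2 + v *: 'X + (beta *: 'X + gamma%:P)%:P.
Local Notation q := newton_quartic.

Lemma coef_quartic i : q`_i =
  nth 0 [:: beta *: 'X + gamma%:P; v; u; 0; 'X^2] i.
Proof.
rewrite !coefD !coefZ !coefXn coefX coefC.
by case: i => [|[|[|[|[|i]]]]] /=; rewrite ?mulr1 ?mulr0 ?addr0 ?add0r ?nth_nil.
Qed.

Lemma size_quartic : size q = 5.
Proof.
apply/eqP; rewrite eqn_leq; apply/andP; split.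
  by apply/leq_sizeP => i i5; rewrite coef_quartic nth_default.
rewrite ltnNge; apply/negP => /leq_sizeP/(_ 4 (leqnn _))/eqP.
by rewrite coef_quartic /= -size_poly_eq0 size_polyXn.
Qed.

(** In degree 8 the terms x^2 z^4 and beta x contribute l^2 and beta l; the bounds
on u and v keep the other terms in degree at most 7. *)
Lemma coef_newton_quartic l k : (7 < k)%N ->
  (newton_poly l 4 q)`_k = if (k == 8)%N then l * (l + beta) else 0.
Proof.
move=> k7; rewrite coef_sum; do 5 rewrite big_ord_recl; rewrite big_ord0 /=.
rewrite !coefMXn !coef_quartic /= !coef_comp_polyZXn // !coefD !coefZ !coefX !coefC !coefXn.
have u0 n : (1 < n)%N -> u`_n = 0 by move=> n1; rewrite nth_default // (leq_trans u2).
have v0 n : (1 < n)%N -> v`_n = 0 by move=> n1; rewrite nth_default // (leq_trans v2).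
rewrite /bump /= !subn0 ltnNge (leq_trans _ k7) //= ltnNge (leq_trans _ k7) //=.
rewrite ltnNge (leq_trans _ k7) //= ltnNge (leq_trans _ k7) //=.
have [->|/eqP k8] := eqVneq k 8%N.
  rewrite -[LHS]/(l ^+ 1 * (beta * 1%:R + 0) + (0 + (0 + (0 + (l ^+ 2 * 1%:R + 0))))).
  ring.
have if0 (t : bool) (y : K) : (t -> y = 0) -> (if t then y else 0) = 0.
  by case: t => // ->.
rewrite !{}if0 ?addr0 // => d4.
- have -> : (k %/ 4 == 2)%N = false by lia.
  by rewrite mulr0.
- by rewrite mulr0.
- by rewrite u0 ?mulr0 //; lia.
- by rewrite v0 ?mulr0 //; lia.
- have -> : ((k - 4) %/ 4 == 1)%N = false by lia.
  by rewrite !mulr0.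
by exfalso; move/eqP: d4 => /=; lia.
Qed.

(** Degrees in T on the left-hand side of the factorization are the same for all
l <> 0; on the right-hand side the value - beta gives a smaller one. *)
Lemma newton_quartic_nofactor l c g h : l != 0 -> l + beta != 0 -> beta != 0 ->
  c != 0 -> g * h = c *: q -> (size g <= 4)%N -> (size h <= 4)%N -> False.
Proof.
move=> l0 lb b0 c0 gh g4 h4.
have E (m : K) : newton_poly m 3 g * newton_poly m 3 h =
    'X^2 * (c \Po (m *: 'X^4)) * newton_poly m 4 q.
  apply/eqP; rewrite -tofrac_eq; apply/eqP; rewrite !rmorphM /=.
  rewrite !newton_polyE ?size_quartic // mulrACA -newton_evM gh.
  rewrite -mul_polyC newton_evM {1}/newton_ev map_polyC hornerC /=; ring.
have c_neq0 (m : K) : m != 0 -> c \Po (m *: 'X^4) != 0.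
  by move=> m0; rewrite comp_poly_eq0 // size_scale // size_polyXn.
have sc (m : K) : m != 0 -> size (c \Po (m *: 'X^4)) = ((size c).-1 * 4).+1.
  by move=> m0; rewrite polySpred ?c_neq0 // size_comp_poly size_scale // size_polyXn.
have sl : size (newton_poly l 4 q) = 9.
  apply/eqP; rewrite eqn_leq; apply/andP; split.
    apply/leq_sizeP => k k9; rewrite coef_newton_quartic ?(leq_trans _ k9) //.
    by rewrite gtn_eqF.
  rewrite ltnNge; apply/negP => /leq_sizeP/(_ 8 (leqnn _))/eqP.
  by rewrite coef_newton_quartic //= mulf_eq0 (negPf l0) (negPf lb).
have sb : (size (newton_poly (- beta) 4 q) <= 8)%N.
  apply/leq_sizeP => k k8; rewrite coef_newton_quartic //.
  by case: eqP => // _; rewrite addNr mulr0.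
have nb0 : - beta != 0 by rewrite oppr_eq0.
have X2 : 'X^2 != 0 :> {poly K} by rewrite -size_poly_eq0 size_polyXn.
have ql : newton_poly l 4 q != 0 by rewrite -size_poly_eq0 sl.
have : newton_poly l 3 g * newton_poly l 3 h != 0.
  by rewrite E (mulf_neq0 (mulf_neq0 X2 (c_neq0 _ l0)) ql).
rewrite mulf_eq0 negb_or => /andP[gl hl].
have nz (m : K) f : m != 0 -> newton_poly l 3 f != 0 -> newton_poly m 3 f != 0.
  by move=> m0; rewrite -!size_poly_eq0 !size_newton_poly.
have qm (m : K) : m != 0 -> newton_poly m 4 q != 0.
  move=> m0; have : newton_poly m 3 g * newton_poly m 3 h != 0.
    exact: mulf_neq0 (nz m g m0 gl) (nz m h m0 hl).
  by rewrite E mulf_eq0 negb_or => /andP[].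
have sE (m : K) : m != 0 -> (size (newton_poly 1 3 g) + size (newton_poly 1 3 h))%N =
    (3 + (size c).-1 * 4 + size (newton_poly m 4 q))%N.
  move=> m0; have := congr1 (fun r : {poly K} => size r) (E m) => /=.
  have Xc := mulf_neq0 X2 (c_neq0 _ m0).
  rewrite (size_mul (nz m g m0 gl) (nz m h m0 hl)) (size_mul Xc (qm m m0)).
  rewrite (size_mul X2 (c_neq0 _ m0)) size_polyXn !(size_newton_poly _ m0) (sc m m0).
  have := qm m m0; have := nz m g m0 gl; have := nz m h m0 hl.
  rewrite -!size_poly_gt0 !(size_newton_poly _ m0).
  move: (size _) (size _) (size _) (size _) => i j i' j'; clear; lia.
move: (sE _ nb0); rewrite (sE l l0) sl => /addnI sb9.
by rewrite -sb9 in sb.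
Qed.

End Newton.

(** * Irreducibility over the field of rational functions *)

Section FractionField.
Variable R : idomainType.
Local Notation tofrac := (@FracField.tofrac R).
Local Open Scope quotient_scope.

Lemma frac_numden (r : {fraction R}) :
  exists n d, d != 0 /\ tofrac d * r = tofrac n.
Proof.
elim/quotW: r => r; exists (\n_r), (\d_r); split; first exact: denom_ratioP.
unlock FracField.tofrac; rewrite !piE /FracField.mulf; apply/eqmodP => /=.
rewrite FracField.equivfE !numden_Ratio ?mul1r ?mulr1 ?oner_eq0 ?denom_ratioP //.
Qed.

Lemma clear_denominators (G : {poly {fraction R}}) :
  exists g d, d != 0 /\ tofrac d *: G = map_poly tofrac g.
Proof.
elim/poly_ind: G => [|G c [g [d [d0 Gg]]]].
  by exists 0, 1; rewrite oner_eq0 scaler0 rmorph0.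
have [n [m [m0 cn]]] := frac_numden c.
exists (m *: g * 'X + (d * n)%:P), (m * d); split; first by rewrite mulf_neq0.
rewrite [RHS]rmorphD [X in _ = X + _]rmorphM /= map_polyX map_polyC map_polyZ /= -Gg.
by rewrite !rmorphM /= -cn -!mul_polyC !rmorphM /=; ring.
Qed.

End FractionField.

Section Irreducible.
Variable K : fieldType.
Local Notation tofrac := (@FracField.tofrac {poly K}).
Variables (u v : {poly K}) (beta gamma l : K).
Hypotheses (u2 : (size u <= 2)%N) (v2 : (size v <= 2)%N).
Hypotheses (beta0 : beta != 0) (l0 : l != 0) (lbeta : l + beta != 0).
Local Notation q := (newton_quartic u v beta gamma).

(** A translation of the variable and a constant factor do not affect
irreducibility; clearing denominators turns a factorization over K(x) into one
over K[x], up to a factor in K[x]. *)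
Lemma irreducible_newton_quartic (P : {poly {fraction {poly K}}}) e w :
  w != 0 -> P \Po ('X + e%:P) = w *: map_poly tofrac q -> irreducible_poly P.
Proof.
move=> w0 Pq.
have sXe : size ('X + e%:P) = 2 by rewrite -[e%:P]opprK -polyCN size_XsubC.
have tofrac_inj : injective tofrac by move=> r s /eqP; rewrite tofrac_eq => /eqP.
have map_inj := map_inj_poly tofrac_inj (rmorph0 _).
have sP : size P = 5.
  by rewrite -(size_comp_poly2 _ sXe) Pq size_scale // size_map_inj_poly ?rmorph0 // size_quartic.
split=> [|d d1 dP]; first by rewrite sP.
rewrite -dvdp_size_eqp // sP; have /dvdpP[r Pr] := dP.
have P0 : P != 0 by rewrite -size_poly_eq0 sP.
have := P0; rewrite {1}Pr mulf_eq0 negb_or => /andP[r0 d0].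
have srd : (size r + size d = 6)%N.
  by have := sP; rewrite Pr size_mul //; case: (_ + _)%N => // n /= ->.
apply/negPn/negP => d5.
have d4 : (size d <= 4)%N by move: (dvdp_leq P0 dP); rewrite sP; move: d5 => /eqP; lia.
have r4 : (size r <= 4)%N by move: d1 d0 srd; rewrite -size_poly_gt0 => /eqP; lia.
have [g [m [m0 gE]]] := clear_denominators (r \Po ('X + e%:P)).
have [h [n [n0 hE]]] := clear_denominators (d \Po ('X + e%:P)).
have [wn [wd [wd0 wE]]] := frac_numden w.
have wn0 : wn != 0 by rewrite -tofrac_eq0 -wE mulf_eq0 tofrac_eq0 (negPf wd0) (negPf w0).
have size_cleared (f : {poly {fraction {poly K}}}) (s : {poly K}) k : s != 0 ->
    tofrac s *: (f \Po ('X + e%:P)) = map_poly tofrac k -> size k = size f.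
  move=> s0 fk; rewrite -(size_map_inj_poly tofrac_inj (rmorph0 _)) -fk.
  by rewrite size_scale ?tofrac_eq0 // (size_comp_poly2 _ sXe).
have gh : (wd *: g) * h = (m * n * wn) *: q.
  apply: map_inj; rewrite rmorphM /= !map_polyZ /= -gE -hE !rmorphM /= -wE.
  move: Pq; rewrite {1}Pr rmorphM /= => Pq.
  transitivity ((tofrac m * tofrac n * tofrac wd) *: (w *: map_poly tofrac q)).
    by rewrite -Pq -!scalerAl -scalerAr !scalerA -mulrA mulrC.
  by rewrite scalerA mulrA.
apply: (newton_quartic_nofactor u2 v2 l0 lbeta beta0 _ gh).
- by rewrite !mulf_eq0 (negPf m0) (negPf n0) (negPf wn0).
- by rewrite (size_scale _ wd0) (size_cleared _ _ _ m0 gE).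
- by rewrite (size_cleared _ _ _ n0 hE).
Qed.

End Irreducible.

(** * The announced minimal polynomial *)

Lemma map_quarticZ (R S : comNzRingType) (f : {rmorphism R -> S}) c r0 r1 r2 r4 :
  f c *: map_poly f (r4 *: 'X^4 + r2 *: 'X^2 + r1 *: 'X + r0%:P) =
  (f (c * r0))%:P + f (c * r1) *: 'X + f (c * r2) *: 'X^2 + f (c * r4) *: 'X^4.
Proof.
rewrite !rmorphD /= !map_polyZ map_polyX !map_polyXn map_polyC /= !scalerDr !scalerA.
by rewrite scale_polyC -!rmorphM; ring.
Qed.

Lemma size_affine (R : nzRingType) (c d : R) : (size (c *: 'X + d%:P)%R <= 2)%N.
Proof.
apply/leq_sizeP => i i2; rewrite coefD coefZ coefX coefC.
by case: i i2 => [|[|i]] //= _; rewrite mulr0 addr0.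
Qed.

Section Quartic.
Variables (K : fieldType) (a : K).
Local Notation tofrac := (@FracField.tofrac {poly K}).
Local Notation laurent := (@laurent_of_ratfun K).

Definition stieltjes_quartic : {poly {poly K}} :=
  'X^2 *: 'X^4 + ((a + 1) *: 'X + 1) *: 'X^2
  + ((a + 1) ^+ 2 *: 'X + (a + 1)%:P) *: 'X
  + ((a * (a + 1) ^+ 3) *: 'X^2 + a%:P)%:P.
Local Notation Q := stieltjes_quartic.

Hypotheses (K2 : 2%:R = 0 :> K) (a1 : a != 1).

Let R2 : 2%:R = 0 :> {poly {poly K}}.
Proof. by rewrite -!polyC_natr K2 !rmorph0. Qed.

Lemma addr1_neq0 : a + 1 != 0.
Proof.
rewrite addr_eq0 (_ : - 1 = 1) //.
by apply/eqP; rewrite eq_sym -subr_eq0 opprK -mulr2n K2.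
Qed.

(** Translating by a fourth root e of a b^3 cancels the x^2 in the constant term,
which is what makes its degree in x equal to 1. *)
Lemma quartic_shift e : e ^+ 4 = a * (a + 1) ^+ 3 ->
  Q \Po ('X + e%:P%:P) =
  newton_quartic ((a + 1) *: 'X + 1) ((a + 1) ^+ 2 *: 'X + (a + 1)%:P)
    ((a + 1) * (e ^+ 2 + (a + 1) * e)) (e ^+ 2 + (a + 1) * e + a).
Proof.
move=> eE; have {eE} : e%:P%:P ^+ 4 = (a * (a + 1) ^+ 3)%:P%:P :> {poly {poly K}}.
  by rewrite -eE !rmorphXn.
rewrite /stieltjes_quartic /newton_quartic -!mul_polyC !(comp_polyD, comp_polyM, comp_polyC, comp_polyX, rmorphXn) /=.
rewrite !(polyCD, polyCM, polyC1, polyC_exp, comp_polyX, comp_polyC).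
set E := e%:P%:P; set A := a%:P%:P; set x := ('X)%:P; set y := 'X.
move: E A x y => E A x y eE.
have -> : (y + E) * ((y + E) * ((y + E) * (y + E))) = y ^+ 4 + E ^+ 4.
  by ring_char2 R2.
rewrite eE; ring_char2 R2.
Qed.

Lemma stiel_root : (map_poly (@fps_of_poly K) Q).[stiel (thue_morse a 1)] = 0.
Proof.
have := scaled_quartic_stiel K2 a1.
rewrite /scaled_quartic /tau /fpsC => E.
have X0 : fps_of_poly 'X != 0 :> fps K.
  by rewrite -(rmorph0 (@fps_of_poly K)) (inj_eq (@fps_of_poly_inj K)) polyX_eq0.
apply: (mulfI (expf_neq0 2 X0)); rewrite mulr0 -[RHS]E.
rewrite /stieltjes_quartic -!mul_polyC.
rewrite !(rmorphD, rmorphM, rmorphXn, map_polyC, map_polyX, rmorph1) /=.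
rewrite !(hornerD, hornerM, hornerXn, hornerC, hornerX).
rewrite !(rmorphD, rmorphM, rmorphXn, map_polyC, map_polyX, rmorph1) /=.
rewrite !(hornerC, hornerX).
move: (fps_of_poly 'X) (fps_of_poly a%:P) (stiel _) => x b y; ring.
Qed.

Lemma laurent_of_poly (p : {poly K}) :
  laurent (tofrac p) = FracField.tofrac (fps_of_poly p).
Proof.
rewrite -[tofrac p]divr1 -(rmorph1 tofrac) laurent_of_ratfunE ?oner_eq0 //.
by rewrite !rmorph1 divr1.
Qed.

Lemma root_quartic_stiel : root (map_poly laurent (map_poly tofrac Q))
  (FracField.tofrac (stiel (thue_morse a 1))).
Proof.
rewrite -map_poly_comp (eq_map_poly (g := @FracField.tofrac (fps K) \o @fps_of_poly K)).
  by rewrite map_poly_comp rootE horner_map stiel_root rmorph0.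
exact: laurent_of_poly.
Qed.

End Quartic.

Theorem mainTheorem2 (k : nat) (K : finFieldType) (a : K)
    (hk : k \in [:: 2; 3; 4]%N) (hK : #|K| = (2 ^ k)%N)
    (ha0 : a != 0) (ha1 : a != 1) :
  let p0 : {poly K} :=
    ((a ^+ 2 + 1) / a ^+ 4) *: 'X^2 + (1 / (a ^+ 5 + a ^+ 4))%:P in
  let p1 : {poly K} := ((a + 1) / a ^+ 5) *: 'X + (1 / a ^+ 5)%:P in
  let p2 : {poly K} := (1 / a ^+ 5) *: 'X + (1 / (a ^+ 6 + a ^+ 5))%:P in
  let p4 : {poly K} := (1 / (a ^+ 6 + a ^+ 5)) *: 'X^2 in
  let P : {poly {fraction {poly K}}} :=
    (FracField.tofrac p0)%:P + FracField.tofrac p1 *: 'X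
    + FracField.tofrac p2 *: 'X^2 + FracField.tofrac p4 *: 'X^4 in
  let S : {fraction (fps K)} :=
    FracField.tofrac (stiel (thue_morse a 1)) in
  [/\ algebraicOver (@laurent_of_ratfun K) S,
      irreducible_poly P
    & root (map_poly (@laurent_of_ratfun K) P) S].
Proof.
move=> p0 p1 p2 p4 P S.
have K2 : 2%:R = 0 :> K.
  by apply/eqP; have /andP[] := card_finPcharP hK isT.
have b0 := addr1_neq0 K2 ha1.
pose c : {poly K} := ((a ^+ 5 * (a + 1))^-1)%:P.
have c0 : FracField.tofrac c != 0.
  by rewrite tofrac_eq0 polyC_eq0 invr_eq0 mulf_eq0 expf_eq0 (negPf ha0) (negPf b0).
have PE : P = FracField.tofrac c *: map_poly (@FracField.tofrac _) (stieltjes_quartic a).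
  have cb2 : (a + 1) ^+ 2 = a ^+ 2 + 1 by ring_char2 K2.
  have d54 : a ^+ 5 + a ^+ 4 = a ^+ 4 * (a + 1) by ring.
  have d65 : a ^+ 6 + a ^+ 5 = a ^+ 5 * (a + 1) by ring.
  have e0 : p0 = c * ((a * (a + 1) ^+ 3) *: 'X^2 + a%:P).
    rewrite mul_polyC scalerDr scalerA scale_polyC /p0 -cb2 d54.
    by congr (_ *: _ + _%:P); field; rewrite ?ha0 ?b0.
  have e1 : p1 = c * ((a + 1) ^+ 2 *: 'X + (a + 1)%:P).
    rewrite mul_polyC scalerDr scalerA scale_polyC /p1.
    by congr (_ *: _ + _%:P); field; rewrite ?ha0 ?b0.
  have e2 : p2 = c * ((a + 1) *: 'X + 1).
    rewrite mul_polyC scalerDr scalerA -polyC1 scale_polyC /p2 d65.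
    by congr (_ *: _ + _%:P); field; rewrite ?ha0 ?b0.
  have e4 : p4 = c * 'X^2.
    by rewrite mul_polyC /p4 d65 div1r.
  by rewrite /P e0 e1 e2 e4 -map_quarticZ.
have rootPS : root (map_poly (@laurent_of_ratfun K) P) S.
  rewrite PE map_polyZ rootE hornerZ mulf_eq0 -[X in _ || X]rootE.
  by rewrite root_quartic_stiel // orbT.
have k0 : (0 < k)%N by move: hk; rewrite !inE; case: (k).
(* A fourth root: the (4 ^ k)-th power map is the identity of a field with 2 ^ k elements. *)
pose e := (a * (a + 1) ^+ 3) ^+ (4 ^ k.-1).
have e4 : e ^+ 4 = a * (a + 1) ^+ 3.
  rewrite /e -exprM -expnSr prednK // (expnMn 2 2 k).
  by rewrite exprM -hK !expf_card.
have e0 : e != 0 by rewrite /e expf_eq0 mulf_eq0 expf_eq0 (negPf ha0) (negPf b0) /= andbF.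
have eb : e + (a + 1) != 0.
  apply/eqP => eb; have b3 : (a + 1) ^+ 3 = 0.
    transitivity ((a + 1) ^+ 4 - a * (a + 1) ^+ 3); first by ring.
    by rewrite -e4 (_ : e = - (a + 1)); [ring | apply/eqP; rewrite -addr_eq0 eb].
  by move/eqP: b3; rewrite expf_eq0 (negPf b0).
set beta := (a + 1) * (e ^+ 2 + (a + 1) * e).
have beta0 : beta != 0.
  rewrite /beta (_ : e ^+ 2 + (a + 1) * e = e * (e + (a + 1))); last by ring.
  by rewrite !mulf_eq0 (negPf e0) (negPf eb) (negPf b0).
(* Any l outside {0, beta} would do; a * beta is one, as a is neither 0 nor 1. *)
have irrP : irreducible_poly P.
  apply: (@irreducible_newton_quartic K ((a + 1) *: 'X + 1)
    ((a + 1) ^+ 2 *: 'X + (a + 1)%:P) beta (e ^+ 2 + (a + 1) * e + a) (a * beta)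
    _ _ beta0 _ _ P (FracField.tofrac e%:P) (FracField.tofrac c) c0).
  - by rewrite -polyC1 size_affine.
  - by rewrite size_affine.
  - by rewrite mulf_eq0 (negPf ha0) (negPf beta0).
  - have -> : a * beta + beta = (a + 1) * beta by rewrite mulrDl mul1r.
    by rewrite mulf_eq0 (negPf b0) (negPf beta0).
  rewrite PE comp_polyZ -quartic_shift //; congr (_ *: _).
  by rewrite map_comp_poly [X in _ = _ \Po X]rmorphD /= map_polyX map_polyC.
split=> //; exists P => //.
by have [P1 _] := irrP; rewrite -size_poly_gt0 (ltn_trans _ P1).
Qed.
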